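(* Let $\mathfrak V$ be a variety of algebras over a field $\mathbf F$. Then $\mathfrak V$ is solvable if and only if $A^2$ is a proper subalgebra of $A$ (that is, $A^2\neq A$) for every nonzero algebra $A\in\mathfrak V$.
   Context: An algebra over a field $\mathbf F$ is a vector space over $\mathbf F$ with a bilinear multiplication (not assumed associative, commutative or unital). A variety of $\mathbf F$-algebras is the class of all $\mathbf F$-algebras satisfying a given set of polynomial identities $v(x_1,\dots,x_n)=0$, where each $v$ is a nonassociative polynomial over $\mathbf F$ without constant term. $A^2$ denotes the linear span of all products $ab$, $a,b\in A$. Put $A^{(1)}=A$ and $A^{(k)}=(A^{(k-1)})^2$ for $k>1$. An algebra $A$ is solvable if $A^{(\ell+1)}=\{0\}$ for some $\ell\ge 0$. A variety is solvable if every algebra in it is solvable. *)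

(* Defs.v *)
From HB Require Import structures.
From mathcomp Require Import all_boot all_algebra.
From mathcomp Require Import classical_sets.
From mathcomp Require Import finmap monalg.

Set Implicit Arguments.
Unset Strict Implicit.
Unset Printing Implicit Defensive.

Import GRing.Theory.
Local Open Scope ring_scope.
Local Open Scope classical_set_scope.

(* No associativity, commutativity or unit; the zero algebra is allowed. *)
Record naAlg (F : fieldType) := NaAlg {
  naAlg_sort :> lmodType F;
  namul : {bilinear naAlg_sort -> naAlg_sort -> naAlg_sort}
}.

(* Nonassociative monomials in the variables x_0, x_1, ...: the free magma on
   nat.  There is no empty monomial, hence linear combinations of monomials
   have no constant term. *)
Inductive namonom : Type :=
| NaVar of nat
| NaMul of namonom & namonom.

Fixpoint namonom_encode (m : namonom) : GenTree.tree nat :=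
  match m with
  | NaVar i => GenTree.Leaf i
  | NaMul m1 m2 =>
      GenTree.Node 0 [:: namonom_encode m1; namonom_encode m2]
  end.

Fixpoint namonom_decode (t : GenTree.tree nat) : namonom :=
  match t with
  | GenTree.Leaf i => NaVar i
  | GenTree.Node _ [:: t1; t2] =>
      NaMul (namonom_decode t1) (namonom_decode t2)
  | _ => NaVar 0
  end.

Lemma namonom_encodeK : cancel namonom_encode namonom_decode.
Proof. by elim=> //= m1 -> m2 ->. Qed.

HB.instance Definition _ := Countable.copy namonom (can_type namonom_encodeK).

(* The free module on the monomials.  A polynomial has finite support, so it
   involves finitely many variables.  Only the module structure of {malg _} is
   used: namonom carries no associative product. *)
Definition napoly (F : fieldType) : Type := {malg F[namonom]}.

Fixpoint namonom_eval (F : fieldType) (A : naAlg F) (a : nat -> A)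
    (m : namonom) : A :=
  match m with
  | NaVar i => a i
  | NaMul m1 m2 => namul A (namonom_eval a m1) (namonom_eval a m2)
  end.

Definition napoly_eval (F : fieldType) (A : naAlg F) (a : nat -> A)
    (v : napoly F) : A :=
  \sum_(m <- msupp v) v@_m *: namonom_eval a m.

Definition satisfies (F : fieldType) (A : naAlg F) (v : napoly F) : Prop :=
  forall a : nat -> A, napoly_eval a v = 0.

(* Classes of algebras are plain predicates: classical_sets' set is not
   universe polymorphic and cannot be applied to the large type naAlg F. *)
Definition is_variety (F : fieldType) (V : naAlg F -> Prop) : Prop :=
  exists I : set (napoly F),
    forall A : naAlg F, V A <-> (forall v, I v -> satisfies A v).

Definition lin_span (F : fieldType) (M : lmodType F) (S : set M) : set M :=
  [set x | exists (n : nat) (c : 'I_n -> F) (y : 'I_n -> M),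
     (forall i, S (y i)) /\ x = \sum_(i < n) c i *: y i].

Definition nasquare (F : fieldType) (A : naAlg F) (X : set A) : set A :=
  lin_span [set namul A x y | x in X & y in X].

(* A^(k): naderived A 1 = A and naderived A k.+1 = (naderived A k)^2 for k > 0;
   the value at k = 0 is irrelevant. *)
Definition naderived (F : fieldType) (A : naAlg F) (k : nat) : set A :=
  iter k.-1 (@nasquare F A) [set: A].

Arguments naderived {F} A k.

Definition nasolvable (F : fieldType) (A : naAlg F) : Prop :=
  exists l : nat, naderived A l.+1 = [set 0].

Definition nonzero_alg (F : fieldType) (A : naAlg F) : Prop :=
  exists a : A, a != 0.

Definition solvable_variety (F : fieldType) (V : naAlg F -> Prop) : Prop :=
  forall A : naAlg F, V A -> nasolvable A.

(* Main.v *)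
Require Import Defs.
From HB Require Import structures.
From mathcomp Require Import all_boot all_algebra.
From mathcomp Require Import boolp functions classical_sets.

(* If some A in V is not solvable, then by multilinearity, for every n, the
   product over the complete binary tree of depth n does not vanish on A: let
   a_n be a labelling of the leaves with nonzero product.  For a binary word w
   let y_w be the sequence whose n-th term is the product over the subtree
   rooted at w of the tree labelled by a_n.  Modulo eventually zero sequences
   y_w = y_(w0) y_(w1), and the class of the y of the empty word is nonzero, so
   these classes generate a nonzero algebra B of V with B^2 = B. *)

Set Implicit Arguments.
Unset Strict Implicit.
Unset Printing Implicit Defensive.

Import GRing.Theory.
Local Open Scope ring_scope.
Local Open Scope quotient_scope.
Local Open Scope classical_set_scope.

(** * Subspaces and linear spans *)

Section Subspaces.

Variables (F : fieldType) (M : lmodType F).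
Implicit Types S T : set M.

Definition is_subspace T :=
  T 0 /\ forall c x y, T x -> T y -> T (c *: x + y).

Lemma subspaceZ T c x : is_subspace T -> T x -> T (c *: x).
Proof. by move=> [T0 TP] Tx; rewrite -[c *: x]addr0; exact: TP. Qed.

Lemma subspaceD T x y : is_subspace T -> T x -> T y -> T (x + y).
Proof. by move=> [_ TP] Tx Ty; rewrite -[x]scale1r; exact: TP. Qed.

Lemma subspace1 : is_subspace [set 0 : M].
Proof. by split=> // c x y /= -> ->; rewrite scaler0 addr0. Qed.

Lemma lin_span_sub S x : S x -> lin_span S x.
Proof.
move=> Sx; exists 1%N, (fun=> 1), (fun=> x); split=> //.
by rewrite big_ord1 scale1r.
Qed.

Lemma lin_span_subspace S : is_subspace (lin_span S).
Proof.
split.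
  by exists 0%N, (fun=> 0), (fun=> 0); rewrite big_ord0; split=> // -[].
move=> c _ _ [n [d [u [Su ->]]]] [m [e [v [Sv ->]]]].
exists (n + m)%N,
  (fun i : 'I_(n + m) =>
    match fintype.split i with inl j => c * d j | inr j => e j end),
  (fun i : 'I_(n + m) =>
    match fintype.split i with inl j => u j | inr j => v j end).
split=> [i|]; first by case: (fintype.split i).
rewrite big_split_ord scaler_sumr; congr (_ + _); apply: eq_bigr => i _.
  by rewrite -[lshift m i]/(unsplit (inl i)) unsplitK scalerA.
by rewrite -[rshift n i]/(unsplit (inr i)) unsplitK.
Qed.

Lemma lin_span_min S T : is_subspace T -> S `<=` T -> lin_span S `<=` T.
Proof.
move=> [T0 TP] ST _ [n [c [y [Sy ->]]]].
elim/big_ind: _ => // [x z Tx Tz|i _]; first exact: subspaceD.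
by apply: subspaceZ => //; exact: ST.
Qed.

End Subspaces.

(** * Derived series and products over complete binary trees *)

Section Multiplication.

Variables (F : fieldType) (A : naAlg F).

(** With its right-hand counterpart, this lets [lin_span_min] reduce the two factors of a product to
    spanning elements one at a time. *)
Lemma namul_subspacel (T : set A) y :
  is_subspace T -> is_subspace [set x | T (namul A x y)].
Proof.
move=> [T0 TP]; split=> [|c x z Tx Tz] /=; first by rewrite linear0l.
by rewrite linearPl; exact: TP.
Qed.

Lemma namul_subspacer (T : set A) x :
  is_subspace T -> is_subspace [set y | T (namul A x y)].
Proof.
move=> [T0 TP]; split=> [|c y z Ty Tz] /=; first by rewrite linear0r.
by rewrite linearPr; exact: TP.
Qed.

Lemma nasquare_mul (X : set A) x y : X x -> X y -> nasquare X (namul A x y).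
Proof. by move=> Xx Xy; apply: lin_span_sub; exists x => //; exists y. Qed.

Lemma naderivedS k : naderived A k.+2 = nasquare (naderived A k.+1).
Proof. by []. Qed.

Lemma naderived_full k :
  nasquare [set: A] = [set: A] -> naderived A k.+1 = [set: A].
Proof. by move=> A2; elim: k => // k IH; rewrite naderivedS IH. Qed.

(* The leaves of the complete binary tree of depth n are the binary words of
   length n; the values of a at other words are irrelevant. *)
Fixpoint treeprod (n : nat) (a : seq bool -> A) : A :=
  if n is m.+1 then
    namul A (treeprod m (fun w => a (false :: w)))
            (treeprod m (fun w => a (true :: w)))
  else a [::].

(** By bilinearity it suffices to multiply two tree products of depth [n]; they are the two halves
    of one of depth [n.+1]. *)
Lemma naderived_treeprod n :
  naderived A n.+1 `<=` lin_span (range (treeprod n)).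
Proof.
elim: n => [x _|n IH]; first by apply: lin_span_sub; exists (fun=> x).
rewrite naderivedS; apply: lin_span_min; first exact: lin_span_subspace.
have spanS := lin_span_subspace (range (treeprod n.+1)).
move=> _ [x /IH Dx [y /IH Dy <-]].
apply: (lin_span_min (namul_subspacel y spanS) _ Dx) => _ [a _ <-] /=.
apply: (lin_span_min (namul_subspacer _ spanS) _ Dy) => _ [b _ <-] /=.
apply: lin_span_sub.
(* The glued labelling uses [a] on the left half and [b] on the right half. Its value at the empty
   word is irrelevant, as that word is not a leaf at depth [n.+1]. *)
exists (fun w => if w is true :: v then b v else a (behead w)) => //.
Qed.

(** Read contrapositively, this gives a nonsolvable algebra a labelling with nonzero product at
    every depth. *)
Lemma treeprod_eq0_solvable n : (forall a, treeprod n a = 0) -> nasolvable A.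
Proof.
move=> t0; exists n; rewrite eqEsubset; split=> [x /naderived_treeprod|_ ->].
  by apply: (lin_span_min (subspace1 A)) => _ [a _ <-]; exact: t0.
case: n {t0} => [//|n]; rewrite naderivedS; exact: (lin_span_subspace _).1.
Qed.

End Multiplication.

(** * Homomorphisms and transfer of identities *)

Section Homomorphisms.

Variables (F : fieldType) (A B : naAlg F).

Definition is_hom (f : A -> B) :=
  linear f /\ {morph f : x y / namul A x y >-> namul B x y}.

Variable f : A -> B.
Hypothesis hom_f : is_hom f.

Lemma homM x y : f (namul A x y) = namul B (f x) (f y).
Proof. exact: hom_f.2. Qed.

Lemma homD x y : f (x + y) = f x + f y.
Proof. by rewrite -{1}[x]scale1r hom_f.1 scale1r. Qed.

Lemma hom0 : f 0 = 0.
Proof. by apply: (addrI (f 0)); rewrite -homD !addr0. Qed.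

Lemma homZ c x : f (c *: x) = c *: f x.
Proof. by rewrite -[c *: x]addr0 hom_f.1 hom0 addr0. Qed.

Lemma namonom_eval_hom a m :
  namonom_eval (fun i => f (a i)) m = f (namonom_eval a m).
Proof. by elim: m => //= m1 -> m2 ->; rewrite homM. Qed.

Lemma napoly_eval_hom a (v : napoly F) :
  napoly_eval (fun i => f (a i)) v = f (napoly_eval a v).
Proof.
rewrite /napoly_eval (big_morph f homD hom0).
by apply: eq_bigr => m _; rewrite homZ namonom_eval_hom.
Qed.

Lemma satisfies_inj v : injective f -> satisfies B v -> satisfies A v.
Proof.
by move=> f_inj Bv a; apply: f_inj; rewrite -napoly_eval_hom Bv hom0.
Qed.

Lemma satisfies_surj v :
  (forall y, exists x, f x = y) -> satisfies A v -> satisfies B v.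
Proof.
(* A set-theoretic section of [f] lifts the whole assignment of the variables to [A]. *)
move=> /choice[g gK] Av b; have -> : b = fun i => f (g (b i)).
  by apply/funext=> i; rewrite gK.
by rewrite napoly_eval_hom Av hom0.
Qed.

End Homomorphisms.

(** * Powers of an algebra *)

Section Power.

Variables (F : fieldType) (A : naAlg F) (I : Type).

Definition pow_mul (f g : I -> A) : I -> A := fun i => namul A (f i) (g i).

Lemma pow_mul_bilinear : bilinear_for *:%R *:%R pow_mul.
Proof.
split=> f c g h; apply/funext=> i; rewrite /pow_mul !fctE.
  by rewrite linearPl.
by rewrite linearPr.
Qed.

HB.instance Definition _ :=
  bilinear_isBilinear.Build F _ _ _ *:%R *:%R pow_mul pow_mul_bilinear.

Definition pow_alg : naAlg F := @NaAlg F (I -> A : lmodType F) pow_mul.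

Lemma satisfies_pow v : satisfies A v -> satisfies pow_alg v.
Proof.
move=> Av a; apply/funext=> i.
(* Each coordinate projection is a homomorphism, so identities can be checked coordinatewise. *)
pose ev (f : pow_alg) : A := f i.
by rewrite -[LHS]/(ev _) -napoly_eval_hom // Av.
Qed.

End Power.

(** * Quotient by a two-sided ideal *)

Section Quotient.

Variables (F : fieldType) (A : naAlg F) (N : set A).
Hypotheses (N_subspace : is_subspace N)
  (Nl : forall x y, N x -> N (namul A x y))
  (Nr : forall x y, N y -> N (namul A x y)).

Definition ideal_pred : {pred A} := fun x => `[< N x >].

Lemma ideal_pred_submod : GRing.submod_closed ideal_pred.
Proof.
split=> [|c x y /asboolP Nx /asboolP Ny]; apply/asboolP.
  exact: N_subspace.1.
exact: N_subspace.2.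
Qed.

HB.instance Definition _ :=
  GRing.isSubmodClosed.Build F A ideal_pred ideal_pred_submod.

Local Notation Q := (Quotient.quot ideal_pred).

Lemma pi_eq x y : \pi_Q x = \pi_Q y <-> N (x - y).
Proof.
split=> [/eqP|Nxy]; first by rewrite -Quotient.idealrBE => /asboolP.
by apply/eqP; rewrite -Quotient.idealrBE; exact/asboolP.
Qed.

Definition qscale (c : F) (x : Q) : Q := \pi_Q (c *: repr x).

(** Representatives of one class differ by an element of [N], which is closed under scaling. *)
Lemma pi_qscale c x : qscale c (\pi_Q x) = \pi_Q (c *: x).
Proof.
apply/pi_eq; rewrite -scalerBr; apply: subspaceZ => //.
by apply/pi_eq; rewrite reprK.
Qed.

Lemma qscaleA c d x : qscale c (qscale d x) = qscale (c * d) x.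
Proof. by rewrite -[x]reprK [qscale d _]pi_qscale !pi_qscale scalerA. Qed.

Lemma qscale1 : left_id 1 qscale.
Proof. by move=> x; rewrite -[x]reprK pi_qscale scale1r. Qed.

Lemma qscaleDr : right_distributive qscale +%R.
Proof.
move=> c x y.
by rewrite -[x]reprK -[y]reprK -raddfD !pi_qscale scalerDr raddfD.
Qed.

Lemma qscaleDl x : {morph qscale^~ x : c d / c + d}.
Proof. by move=> c d; rewrite -[x]reprK !pi_qscale scalerDl raddfD. Qed.

HB.instance Definition _ :=
  GRing.Zmodule_isLmodule.Build F Q qscaleA qscale1 qscaleDr qscaleDl.

Lemma pi_linear : linear \pi_Q.
Proof. by move=> c x y; rewrite raddfD /= -pi_qscale. Qed.

Definition qmul (x y : Q) : Q := \pi_Q (namul A (repr x) (repr y)).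

Lemma pi_qmul x y : qmul (\pi_Q x) (\pi_Q y) = \pi_Q (namul A x y).
Proof.
have NpiK z : N (repr (\pi_Q z) - z) by apply/pi_eq; rewrite reprK.
(* With representatives x' and y', the difference x'y' - xy equals (x' - x)y' + x(y' - y); [Nl] and
   [Nr] absorb the two terms. *)
apply/pi_eq; rewrite -[_ - _](subrKA (namul A x (repr (\pi_Q y)))).
by rewrite -linearBl -linearBr; apply: subspaceD; auto.
Qed.

Lemma qmul_bilinear : bilinear_for *:%R *:%R qmul.
Proof.
split=> x c y z; rewrite -[x]reprK -[y]reprK -[z]reprK /= -[in LHS]pi_linear.
  by rewrite !pi_qmul linearPl pi_linear.
by rewrite !pi_qmul linearPr pi_linear.
Qed.

HB.instance Definition _ :=
  bilinear_isBilinear.Build F _ _ _ *:%R *:%R qmul qmul_bilinear.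

Lemma quotient_alg : exists (B : naAlg F) (f : A -> B),
  [/\ is_hom f, forall y, exists x, f x = y & forall x, f x = 0 <-> N x].
Proof.
exists (@NaAlg F Q qmul), \pi_Q; split.
- by split=> [|x y]; [exact: pi_linear | rewrite -pi_qmul].
- by move=> y; exists (repr y); rewrite reprK.
- by move=> x; rewrite -[x in N x]subr0 -pi_eq raddf0.
Qed.

End Quotient.

(** * Subalgebras *)

Section Subalgebra.

Variables (F : fieldType) (A : naAlg F) (S : set A).
Hypotheses (S_subspace : is_subspace S)
  (SM : forall x y, S x -> S y -> S (namul A x y)).

Definition sub_pred (x : A) := `[< S x >].

Lemma sub_pred_submod : GRing.submod_closed sub_pred.
Proof.
split=> [|c x y /asboolP Sx /asboolP Sy]; apply/asboolP.
  exact: S_subspace.1.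
exact: S_subspace.2.
Qed.

HB.instance Definition _ :=
  GRing.isSubmodClosed.Build F A sub_pred sub_pred_submod.

Record subalg :=
  Subalg { subalg_val : A; subalg_valP : subalg_val \in sub_pred }.

HB.instance Definition _ := [isSub for subalg_val].
HB.instance Definition _ := [Choice of subalg by <:].
HB.instance Definition _ := [SubChoice_isSubLmodule of subalg by <:].

Lemma submul_subproof (x y : subalg) : namul A (\val x) (\val y) \in sub_pred.
Proof. by apply/asboolP/SM; apply/asboolP; exact: subalg_valP. Qed.

Definition submul (x y : subalg) : subalg := Subalg (submul_subproof x y).

Lemma submul_bilinear : bilinear_for *:%R *:%R submul.
Proof.
split=> x c y z; apply: val_inj => /=.
  exact: linearPl.
exact: linearPr.
Qed.

HB.instance Definition _ :=
  bilinear_isBilinear.Build F _ _ _ *:%R *:%R submul submul_bilinear.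

Lemma subalgebra_alg : exists (B : naAlg F) (f : B -> A),
  [/\ is_hom f, injective f & range f = S].
Proof.
exists (@NaAlg F subalg submul), \val; split; [|exact: val_inj|].
  by split=> // c x y; rewrite linearP.
rewrite eqEsubset; split=> [_ [[x /asboolP Sx] _ <-] //|x Sx].
have xS : x \in sub_pred by exact/asboolP.
by exists (Subalg xS).
Qed.

End Subalgebra.

(** * Generated subalgebras equal to their square *)

Section GeneratedSubalgebra.

Variables (F : fieldType) (A : naAlg F) (G : set A).

Inductive generated : A -> Prop :=
| generated_gen x of G x : generated x
| generated0 : generated 0
| generatedP c x y of generated x & generated y : generated (c *: x + y)
| generatedM x y of generated x & generated y : generated (namul A x y).

(* The square of the generated subalgebra is a subspace which contains all
   products and, by hypothesis, the generators: it is everything. *)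
Lemma perfect_subalgebra :
  (forall g, G g -> exists x y, [/\ G x, G y & g = namul A x y]) ->
  exists (B : naAlg F) (f : B -> A),
    [/\ is_hom f, injective f, G `<=` range f & nasquare [set: B] = [set: B]].
Proof.
move=> GM.
have gen_sub : is_subspace generated.
  by split; [exact: generated0 | exact: generatedP].
have [B [f [hom_f f_inj im_f]]] := subalgebra_alg gen_sub generatedM.
have lift x : generated x -> exists b, f b = x.
  by rewrite -im_f => -[b _ <-]; exists b.
exists B, f; split=> //; first by rewrite im_f => x; exact: generated_gen.
rewrite eqEsubset; split=> // b _.
have sq := lin_span_subspace [set namul B x y | x in [set: B] & y in [set: B]].
(* Induction on membership needs a free [x] in place of [f b]; injectivity of [f] then identifies
   [b] in each case. *)
suff H x : generated x -> forall b, f b = x -> nasquare [set: B] b.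
  have : generated (f b) by rewrite -im_f; exists b.
  by move=> /H; exact.
elim=> {b x} [g /GM[x [y [Gx Gy ->]]]||c x y gx IHx gy IHy|x y gx _ gy _] b fb.
- have [u fu] := lift _ (generated_gen Gx).
  have [v fv] := lift _ (generated_gen Gy).
  suff -> : b = namul B u v by apply: nasquare_mul.
  by apply: f_inj; rewrite homM // fu fv.
- suff -> : b = 0 by exact: sq.1.
  by apply: f_inj; rewrite fb hom0.
- have [[u fu] [v fv]] := (lift _ gx, lift _ gy).
  suff -> : b = c *: u + v by apply: sq.2; [exact: IHx | exact: IHy].
  by apply: f_inj; rewrite fb hom_f.1 fu fv.
- have [[u fu] [v fv]] := (lift _ gx, lift _ gy).
  suff -> : b = namul B u v by apply: nasquare_mul.
  by apply: f_inj; rewrite homM // fu fv.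
Qed.

End GeneratedSubalgebra.

(** * Tree products modulo eventually zero sequences *)

(** Dividing by this ideal discards the finitely many depths at which a given word is not an inner
    vertex of the tree. *)
Definition eventually0 (F : fieldType) (A : naAlg F) : set (pow_alg A nat) :=
  [set f : nat -> A | exists n, forall m, (n <= m)%N -> f m = 0].

(** [B] inherits the identities of [A] as a subalgebra of a quotient of a power of [A]. *)
Lemma nonsolvable_perfect (F : fieldType) (A : naAlg F) :
  ~ nasolvable A ->
  exists B : naAlg F, [/\ forall v, satisfies A v -> satisfies B v,
    nonzero_alg B & nasquare [set: B] = [set: B]].
Proof.
move=> nsolA.
have nz n : exists a : seq bool -> A, treeprod n a != 0.
  apply: contrapT => t0; apply: nsolA.
  apply: (treeprod_eq0_solvable (n := n)) => a.
  by apply/eqP; apply/negPn/negP => ta; apply: t0; exists a.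
have [a a_neq0] := choice nz.
pose N := @eventually0 F A.
have N_sub : is_subspace N.
  split=> [|c x y [n xn] [m ym]]; first by exists 0%N.
  exists (maxn n m) => k; rewrite geq_max => /andP[nk mk].
  by rewrite !fctE xn // ym // scaler0 addr0.
have Nl x y : N x -> N (namul (pow_alg A nat) x y).
  by move=> [n xn]; exists n => m nm; rewrite /= /pow_mul xn // linear0l.
have Nr x y : N y -> N (namul (pow_alg A nat) x y).
  by move=> [n xn]; exists n => m nm; rewrite /= /pow_mul xn // linear0r.
have [Q [q [hom_q q_surj q_eq0]]] := quotient_alg N_sub Nl Nr.
(* The subtree at [w] has depth [n - size w]; terms with [n < size w] are junk that vanishes modulo
   [N]. *)
pose y (w : seq bool) : pow_alg A nat :=
  fun n => treeprod (n - size w) (fun u => a n (w ++ u)).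
have yM w : q (y w) = namul Q (q (y (rcons w false))) (q (y (rcons w true))).
  rewrite -homM //; apply/eqP; rewrite -subr_eq0 -scaleN1r addrC; apply/eqP.
  (* From this index on the subtree at [w] has depth at least 1 and splits at its root. *)
  rewrite -hom_q.1; apply/q_eq0; exists (size w).+1 => n wn.
  rewrite !fctE /= /pow_mul /y !size_rcons -(subnSK wn) /=.
  have rc b : (fun u => a n (rcons w b ++ u)) = fun u => a n (w ++ b :: u).
    by apply/funext=> u; rewrite cat_rcons.
  by rewrite !rc scaleN1r addNr.
pose G : set Q := range (q \o y).
have [|B [f [hom_f f_inj Gf B2]]] := @perfect_subalgebra F Q G.
  move=> _ [w _ <-]; exists (q (y (rcons w false))), (q (y (rcons w true))).
  split; [by exists (rcons w false) | by exists (rcons w true) | exact: yM].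
exists B; split=> // [v Av|].
  by apply: (satisfies_inj hom_f f_inj); apply: (satisfies_surj hom_q q_surj);
    exact: satisfies_pow.
have [b _ fb] : range f (q (y [::])) by apply: Gf; exists [::].
exists b; apply/eqP => b0; move: fb; rewrite b0 (hom0 hom_f) => /esym/q_eq0.
(* At the empty word every term is a full tree product, hence nonzero, so no bound [n] can work. *)
by move=> [n /(_ n (leqnn n))] /eqP; rewrite /y subn0 (negPf (a_neq0 n)).
Qed.

Theorem theorem15 (F : fieldType) (V : naAlg F -> Prop) (hV : is_variety V) :
  solvable_variety V <->
  (forall A : naAlg F, V A -> nonzero_alg A -> nasquare [set: A] <> [set: A]).
Proof.
split=> [solV A VA [a a_neq0] A2 | properV A VA].
  (* If A^2 = A, the derived series stays at A, yet solvability makes one of its terms zero. *)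
  have [l Al] := solV A VA; move: a_neq0; apply/negP; rewrite negbK.
  by apply/eqP; rewrite -[a = 0]/([set 0] a) -Al naderived_full.
apply: contrapT => /nonsolvable_perfect[B [AB B_neq0 B2]].
apply: properV B_neq0 B2; have [I VI] := hV.
by apply/VI => v Iv; apply: AB; exact: (VI A).1.
Qed.
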